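(* Let $m$ and $n$ be arbitrary integers. An element $(a,b)$ of the semigroup $\mathscr{C}_{\mathbb{Z}}^{m,n}$ is an idempotent (i.e. $(a,b)\ast_{m,n}(a,b)=(a,b)$) if and only if $(a,b)=(n+i,m+i)$ for some non-negative integer $i$.
   Context: The extended bicyclic semigroup $\mathscr{C}_{\mathbb{Z}}$ is the set $\mathbb{Z}\times\mathbb{Z}$ with the associative operation $(a,b)\cdot(c,d)=(a-b+c,d)$ if $b<c$; $(a,d)$ if $b=c$; $(a,d+b-c)$ if $b>c$. For integers $m,n$, the variant $\mathscr{C}_{\mathbb{Z}}^{m,n}$ is the set $\mathbb{Z}\times\mathbb{Z}$ with the semigroup operation $(a,b)\ast_{m,n}(c,d)=(a,b)\cdot(m,n)\cdot(c,d)$. *)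

(* Defs.v *)
From HB Require Import structures.
From mathcomp Require Import all_boot all_order all_algebra.
From mathcomp Require Import zify.

Set Implicit Arguments.
Unset Strict Implicit.
Unset Printing Implicit Defensive.

Import Order.TTheory GRing.Theory Num.Theory.
Local Open Scope ring_scope.

Definition extbicyclic : Type := (int * int)%type.

HB.instance Definition _ := Choice.on extbicyclic.

Definition extbicyclic_mul (x y : extbicyclic) : extbicyclic :=
  let: (a, b) := x in let: (c, d) := y in
  if b < c then (a - b + c, d)
  else if b == c then (a, d)
  else (a, d + b - c).

Lemma extbicyclic_mulA : associative extbicyclic_mul.
Proof.
move=> [a b] [c d] [e f]; rewrite /extbicyclic_mul.
by do ![case: ifP => ?]; congr pair; lia.
Qed.

HB.instance Definition _ :=
  isSemigroup.Build extbicyclic extbicyclic_mulA.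

(* The indices m and n do not occur in the body: they only select the product
   put on the carrier, so this type must be kept folded when writing a product
   of elements of the variant. *)
Definition extbicyclic_variant (m n : int) : Type := extbicyclic.

HB.instance Definition _ (m n : int) := Choice.on (extbicyclic_variant m n).

Definition extbicyclic_variant_mul (m n : int)
    (x y : extbicyclic_variant m n) : extbicyclic_variant m n :=
  ((x : extbicyclic) * ((m, n) : extbicyclic) * (y : extbicyclic))%g.

Lemma extbicyclic_variant_mulA (m n : int) :
  associative (@extbicyclic_variant_mul m n).
Proof. by move=> x y z; rewrite /extbicyclic_variant_mul !mulgA. Qed.

HB.instance Definition _ (m n : int) :=
  isSemigroup.Build (extbicyclic_variant m n) (@extbicyclic_variant_mulA m n).

Definition idempotent_elt (S : semigroupType) (x : S) : Prop := (x * x)%g = x.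

(* Main.v *)
Require Import Defs.
From HB Require Import structures.
From mathcomp Require Import all_boot all_order all_algebra.
From mathcomp Require Import zify.
Import Order.TTheory GRing.Theory Num.Theory.
Local Open Scope ring_scope.

(** If [b < m], the sandwich product has first coordinate strictly above [a]. If [b >= m], then
    [(a, b) * (m, n) = (a, n + b - m)], and multiplying this by [(a, b)] returns [(a, b)] exactly
    when [n + b - m = a]. So idempotency means [a - n = b - m >= 0]. *)

Theorem proposition2p2 (m n a b : int) :
  idempotent_elt ((a, b) : extbicyclic_variant m n) <->
  exists i : nat, (a, b) = (n + i%:Z, m + i%:Z).
Proof.
rewrite /idempotent_elt.
(* The variant product is convertible to this explicit formula. *)
change (extbicyclic_mul (extbicyclic_mul (a, b) (m, n)) (a, b) = (a, b) <->
  exists i : nat, (a, b) = (n + i%:Z, m + i%:Z)).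
rewrite /extbicyclic_mul; split=> [|[i [-> ->]]].
(* Consistent branches have [b >= m], so the witness is [b - m] itself; the others are
   contradictory. *)
- by do ![case: ifP => ?] => /pair_equal_spec[? ?]; exists `|b - m|%N; congr pair; lia.
- by do ![case: ifP => ?]; congr pair; lia.
Qed.
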